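(* Let $Q$ be a loop with neutral element $1$ and let $A$ be a normal subloop of $Q$. The following conditions are equivalent: (A1) $A$ is abelian in $Q$, that is, $[A,A]_Q=1$. (A2) For every inner word $W$ (in variables $x_1,\dots,x_n$) and all $u_1,\dots,u_n,v_1,\dots,v_n\in Q$ such that $u_i/v_i\in A$ for every $i$, the restriction of $W_{\bar u}W_{\bar v}^{-1}$ to $A$ is the identity mapping of $A$. (A3) For every $\varphi\in\mathrm{Inn}(Q)$ the restriction $\varphi|_A$ is an automorphism of $A$, and $$[a,b]=[a,b,x]=[a,x,b]=[x,a,b]=1,\qquad [a,x,u]=[a,x,v]$$ for all $a,b\in A$ and all $x,u,v\in Q$ with $u/v\in A$. (A4) $Q$ is an abelian extension of $A$ by $Q/A$; that is, $A$ is a commutative group and there are a loop cocycle $\Gamma$ and a loop isomorphism $f: A:_\Gamma (Q/A)\to Q$ such that $f(a,A)=a$ for every $a\in A$ (where $A$ in the second coordinate is the neutral element of $Q/A$) and $f(a,X)\in X$ for every $a\in A$ and every coset $X\in Q/A$.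
   Context: Loops. A quasigroup is a set $Q$ with a binary operation such that all translations $L_x(y)=xy$ and $R_x(y)=yx$ are bijections of $Q$; put $x\backslash y=L_x^{-1}(y)$ and $y/x=R_x^{-1}(y)$. A loop is a quasigroup with a neutral element $1$. Let $M_x(y)=y\backslash x$ (a bijection, $M_x^{-1}(y)=x/y$). $\mathrm{Mlt}(Q)$ is the permutation group generated by all $L_x,R_x$ ($x\in Q$), and $\mathrm{Inn}(Q)=\{\varphi\in\mathrm{Mlt}(Q):\varphi(1)=1\}$. A subloop is normal if it is the kernel of a loop homomorphism (equivalently, it is mapped onto itself by every $\varphi\in\mathrm{Inn}(Q)$). Inner words. A word $W$ is a formal product of letters $L_{t(\bar x)}$, $R_{t(\bar x)}$ and their inverses, where $t(\bar x)=t(x_1,\dots,x_n)$ are loop terms. Substituting elements $u_i$ of a loop $Q$ for the variables $x_i$ and interpreting the letters as translations of $Q$ gives $W_{\bar u}\in\mathrm{Mlt}(Q)$. $W$ is an inner word if $W_{\bar u}(1)=1$ for every loop $Q$ and all $u_i\in Q$. Commutator of normal subloops. Put $T_x=R_x^{-1}L_x$, $U_x=R_x^{-1}M_x$, $L_{x,y}=L_{xy}^{-1}L_xL_y$, $R_{x,y}=R_{yx}^{-1}R_xR_y$, $M_{x,y}=M_{y\backslash x}^{-1}M_xM_y$ (maps are composed right to left). For normal subloops $A,B$ of $Q$, the commutator $[A,B]_Q$ is the smallest normal subloop of $Q$ containing all elements $W_{\bar u}(a)/W_{\bar v}(a)$ with $W\in\{T_x,U_x,L_{x,y},R_{x,y},M_{x,y}\}$,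 $a\in A$, $u_i,v_i\in Q$, $u_i/v_i\in B$. (This is the Freese–McKenzie commutator of the corresponding congruences.) $1$ also denotes the trivial subloop. Commutators and associators of elements: $[y,x]=T_y(x)/x=((yx)/y)/x$ and $[x,y,z]=R_{z,y}(x)/x=(((xy)z)/(yz))/x$. Abelian extensions. Let $(A,+,0)$ be a commutative group and $F$ a loop with neutral element $1$. A loop cocycle is a triple $\Gamma=(\varphi,\psi,\theta)$ of maps $\varphi,\psi:F\times F\to\mathrm{Aut}(A)$, $\theta:F\times F\to A$ with $\varphi_{y,1}=\mathrm{id}=\psi_{1,y}$ and $\theta_{1,y}=0=\theta_{y,1}$ for all $y\in F$. The abelian extension $A:_\Gamma F$ is the loop on $A\times F$ with multiplication $$(a,x)(b,y)=(\varphi_{x,y}(a)+\psi_{x,y}(b)+\theta_{x,y},\,xy)$$ and neutral element $(0,1)$. In (A4), the group operation on $A$ is the multiplication inherited from $Q$. *)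

(* Defs.v *)
From HB Require Import structures.
From mathcomp Require Import all_boot ssralg.
From mathcomp Require Import boolp classical_sets functions.

Set Implicit Arguments.
Unset Strict Implicit.
Unset Printing Implicit Defensive.

Import GRing.Theory.

Local Open Scope classical_set_scope.
Local Open Scope group_scope.

(* MathComp's [{perm T}] requires [T] to be finite. *)
Record permutation (T : Type) := Permutation {
  perm_fun :> T -> T;
  perm_inv : T -> T;
  perm_funK : cancel perm_fun perm_inv;
  perm_invK : cancel perm_inv perm_fun }.

Lemma permutation_eq (T : Type) (p q : permutation T) : p =1 q -> p = q.
Proof.
case: p q => [f f' fK f'K] [g g' gK g'K] /= /funext efg.
have efg' : f' = g' by apply/funext => x; rewrite -[in LHS](g'K x) -efg fK.
by subst g g'; congr Permutation; apply: Prop_irrelevance.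
Qed.

Section PermutationGroup.
Variable T : Type.
Implicit Types p q : permutation T.

Definition perm_one : permutation T :=
  @Permutation T id id (fun=> erefl) (fun=> erefl).
(* Right-to-left composition: [(p * q) x = p (q x)]. *)
Definition perm_mul p q : permutation T :=
  Permutation (can_comp (@perm_funK T p) (@perm_funK T q))
              (can_comp (@perm_invK T q) (@perm_invK T p)).
Definition perm_opp p : permutation T :=
  Permutation (@perm_invK T p) (@perm_funK T p).

Fact perm_mulA : associative perm_mul.
Proof. by move=> p q r; apply: permutation_eq. Qed.
Fact perm_mul1p : left_id perm_one perm_mul.
Proof. by move=> p; apply: permutation_eq. Qed.
Fact perm_mulp1 : right_id perm_one perm_mul.
Proof. by move=> p; apply: permutation_eq. Qed.
Fact perm_mulVp : left_inverse perm_one perm_opp perm_mul.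
Proof. by move=> p; apply: permutation_eq => x; apply: perm_funK. Qed.
Fact perm_mulpV : right_inverse perm_one perm_opp perm_mul.
Proof. by move=> p; apply: permutation_eq => x; apply: perm_invK. Qed.

HB.instance Definition _ := gen_eqMixin (permutation T).
HB.instance Definition _ := gen_choiceMixin (permutation T).
HB.instance Definition _ := isGroup.Build (permutation T)
  perm_mulA perm_mul1p perm_mulp1 perm_mulVp perm_mulpV.
End PermutationGroup.

(* [ldiv x] and [fun y => rdiv y x] are the inverses of the translations
   [y |-> x * y] and [y |-> y * x]; they are determined by the product. *)
HB.mixin Record BaseUMagma_isLoop Q of BaseUMagma Q := {
  ldiv : Q -> Q -> Q;
  rdiv : Q -> Q -> Q;
  lmul1 : forall x : Q, 1 * x = x;
  rmul1 : forall x : Q, x * 1 = x;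
  lmulK : forall x : Q, cancel (fun y => x * y) (ldiv x);
  ldivK : forall x : Q, cancel (ldiv x) (fun y => x * y);
  rmulK : forall x : Q, cancel (fun y => y * x) (fun y => rdiv y x);
  rdivK : forall x : Q, cancel (fun y => rdiv y x) (fun y => y * x) }.

#[short(type="loopType")]
HB.structure Definition Loop := {Q of BaseUMagma_isLoop Q & BaseUMagma Q}.

Local Notation "x \\ y" := (ldiv x y)
  (at level 40, left associativity) : group_scope.
(* From here on [x / y] is loop division, not [x * y^-1]. *)
Local Notation "x / y" := (rdiv x y) : group_scope.

Section LoopTheory.
Variable Q : loopType.
Implicit Types x y : Q.

Fact ldiv_rdivK x : cancel (fun y => y \\ x) (fun y => x / y).
Proof. by move=> y; rewrite -{1}(ldivK y x) rmulK. Qed.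
Fact rdiv_ldivK x : cancel (fun y => x / y) (fun y => y \\ x).
Proof. by move=> y; rewrite -{2}(rdivK y x) lmulK. Qed.

Definition ltrans x : permutation Q := Permutation (lmulK x) (ldivK x).
Definition rtrans x : permutation Q := Permutation (rmulK x) (rdivK x).
Definition mtrans x : permutation Q :=
  Permutation (ldiv_rdivK x) (rdiv_ldivK x).

Inductive Mlt : permutation Q -> Prop :=
| Mlt_ltrans x : Mlt (ltrans x)
| Mlt_rtrans x : Mlt (rtrans x)
| Mlt_one : Mlt 1
| Mlt_mul p q : Mlt p -> Mlt q -> Mlt (p * q)
| Mlt_inv p : Mlt p -> Mlt p^-1.

Definition Inn : set (permutation Q) := [set p | Mlt p /\ p 1 = 1].

Definition Tin x : permutation Q := (rtrans x)^-1 * ltrans x.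
Definition Uin x : permutation Q := (rtrans x)^-1 * mtrans x.
Definition Lin x y : permutation Q :=
  (ltrans (x * y))^-1 * (ltrans x * ltrans y).
Definition Rin x y : permutation Q :=
  (rtrans (y * x))^-1 * (rtrans x * rtrans y).
Definition Min x y : permutation Q :=
  (mtrans (y \\ x))^-1 * (mtrans x * mtrans y).

Definition loop_comm y x : Q := Tin y x / x.
Definition loop_assoc x y z : Q := Rin z y x / x.

Fact loop_commE y x : loop_comm y x = ((y * x) / y) / x.
Proof. by []. Qed.
Fact loop_assocE x y z : loop_assoc x y z = (((x * y) * z) / (y * z)) / x.
Proof. by []. Qed.

End LoopTheory.

Inductive loop_term (n : nat) :=
| TVar of 'I_n
| TOne
| TMul of loop_term n & loop_term n
| TLdiv of loop_term n & loop_term n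
| TRdiv of loop_term n & loop_term n.

Inductive letter (n : nat) :=
| LetL of loop_term n
| LetR of loop_term n
| LetLinv of loop_term n
| LetRinv of loop_term n.

Definition word (n : nat) := seq (letter n).

Section Evaluation.
Variables (n : nat) (Q : loopType) (u : 'I_n -> Q).

Fixpoint term_eval (t : loop_term n) : Q :=
  match t with
  | TVar i => u i
  | TOne => 1
  | TMul s t => term_eval s * term_eval t
  | TLdiv s t => term_eval s \\ term_eval t
  | TRdiv s t => term_eval s / term_eval t
  end.

Definition letter_eval (l : letter n) : permutation Q :=
  match l with
  | LetL t => ltrans (term_eval t)
  | LetR t => rtrans (term_eval t)
  | LetLinv t => (ltrans (term_eval t))^-1
  | LetRinv t => (rtrans (term_eval t))^-1
  end.

Definition word_eval (W : word n) : permutation Q :=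
  \prod_(l <- W) letter_eval l.

End Evaluation.

Definition inner_word (n : nat) (W : word n) : Prop :=
  forall (Q : loopType) (u : 'I_n -> Q), word_eval u W 1 = 1.

Definition is_normal (Q : loopType) (A : set Q) : Prop :=
  exists (F : loopType) (h : {multiplicative Q -> F}), A = h @^-1` [set 1].

Record normalSubloop (Q : loopType) := NormalSubloop {
  nsub_set :> Q -> Prop;
  nsubP : is_normal nsub_set }.

Section Morphism.
Variables (Q F : loopType) (h : {multiplicative Q -> F}).

Fact loop_morphM : {morph h : x y / x * y}.
Proof. exact: gmulfM. Qed.
Fact loop_morph1 : h 1 = 1.
Proof. by rewrite -[LHS](lmulK (h 1)) -loop_morphM rmul1 -{2}(rmul1 (h 1)) lmulK. Qed.
Fact loop_morph_ldiv : {morph h : x y / x \\ y}.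
Proof. by move=> x y; rewrite -[LHS](lmulK (h x)) -loop_morphM ldivK. Qed.
Fact loop_morph_rdiv : {morph h : x y / x / y}.
Proof. by move=> x y; rewrite -[LHS](rmulK (h y)) -loop_morphM rdivK. Qed.

End Morphism.

Section Subloop.
Variables (Q : loopType) (A : normalSubloop Q).

Definition subloop : Type := set_type A.

Fact nsub1 : 1 \in (A : set Q).
Proof. by case: (nsubP A) => F [h ->]; rewrite inE /= loop_morph1. Qed.
Fact nsubM x y : x \in (A : set Q) -> y \in (A : set Q) -> x * y \in (A : set Q).
Proof.
case: (nsubP A) => F [h ->]; rewrite !inE /= => hx hy.
by rewrite loop_morphM hx hy rmul1.
Qed.
Fact nsub_ldiv x y :
  x \in (A : set Q) -> y \in (A : set Q) -> x \\ y \in (A : set Q).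
Proof.
case: (nsubP A) => F [h ->]; rewrite !inE /= => hx hy.
by rewrite loop_morph_ldiv hx hy -{2}(rmul1 1) lmulK.
Qed.
Fact nsub_rdiv x y :
  x \in (A : set Q) -> y \in (A : set Q) -> x / y \in (A : set Q).
Proof.
case: (nsubP A) => F [h ->]; rewrite !inE /= => hx hy.
by rewrite loop_morph_rdiv hx hy -{1}(rmul1 1) rmulK.
Qed.

Definition sub_one : subloop := exist _ 1 nsub1.
Definition sub_mul (a b : subloop) : subloop :=
  exist _ (val a * val b) (nsubM (valP a) (valP b)).
Definition sub_ldiv (a b : subloop) : subloop :=
  exist _ (val a \\ val b) (nsub_ldiv (valP a) (valP b)).
Definition sub_rdiv (a b : subloop) : subloop :=
  exist _ (val a / val b) (nsub_rdiv (valP a) (valP b)).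

HB.instance Definition _ := hasMul.Build subloop sub_mul.
HB.instance Definition _ := hasOne.Build subloop sub_one.

Fact sub_mull1 (x : subloop) : 1 * x = x.
Proof. by apply: val_inj; apply: lmul1. Qed.
Fact sub_mulr1 (x : subloop) : x * 1 = x.
Proof. by apply: val_inj; apply: rmul1. Qed.
Fact sub_mulKl (x : subloop) : cancel (fun y => x * y) (sub_ldiv x).
Proof. by move=> y; apply: val_inj; apply: lmulK. Qed.
Fact sub_ldivK (x : subloop) : cancel (sub_ldiv x) (fun y => x * y).
Proof. by move=> y; apply: val_inj; apply: ldivK. Qed.
Fact sub_mulrK (x : subloop) : cancel (fun y => y * x) (sub_rdiv^~ x).
Proof. by move=> y; apply: val_inj; apply: rmulK. Qed.
Fact sub_rdivK (x : subloop) : cancel (sub_rdiv^~ x) (fun y => y * x).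
Proof. by move=> y; apply: val_inj; apply: rdivK. Qed.

HB.instance Definition _ := BaseUMagma_isLoop.Build subloop
  sub_mull1 sub_mulr1 sub_mulKl sub_ldivK sub_mulrK sub_rdivK.

End Subloop.

Section Quotient.
Variables (Q : loopType) (A : normalSubloop Q).

Definition coset (x : Q) : set Q := [set x * a | a in A].

(* The operations of [Q / A] are the elementwise operations on cosets. *)
Definition quotient : Type := set_type (range coset).

Fact coset_mul x y : [set u * v | u in coset x & v in coset y] = coset (x * y).
Proof.
rewrite /coset; case: (nsubP A) => F [h ->].
apply/seteqP; split=> [_ [_ [a ha <-] [_ [b hb <-] <-]]|_ [c hc <-]] /=.
  exists ((x * y) \\ ((x * a) * (y * b))); last by rewrite ldivK.
  rewrite /= loop_morph_ldiv !loop_morphM ha hb !rmul1.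
  by rewrite -[X in _ \\ X]rmul1 lmulK.
exists x; first by exists 1; [rewrite /= loop_morph1 | rewrite rmul1].
exists (x \\ (x * y * c)); last by rewrite ldivK.
exists (y \\ (x \\ (x * y * c))); last by rewrite ldivK.
rewrite /= !loop_morph_ldiv !loop_morphM hc rmul1 lmulK.
by rewrite -[X in _ \\ X]rmul1 lmulK.
Qed.

Fact coset_ldiv x y :
  [set u \\ v | u in coset x & v in coset y] = coset (x \\ y).
Proof.
rewrite /coset; case: (nsubP A) => F [h ->].
apply/seteqP; split=> [_ [_ [a ha <-] [_ [b hb <-] <-]]|_ [c hc <-]] /=.
  exists ((x \\ y) \\ ((x * a) \\ (y * b))); last by rewrite ldivK.
  rewrite /= !loop_morph_ldiv !loop_morphM ha hb !rmul1.
  by rewrite -[X in _ \\ X]rmul1 lmulK.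
exists x; first by exists 1; [rewrite /= loop_morph1 | rewrite rmul1].
exists (x * (x \\ y * c)); last by rewrite lmulK.
exists (y \\ (x * (x \\ y * c))); last by rewrite ldivK.
rewrite /= loop_morph_ldiv !loop_morphM hc rmul1 -loop_morphM ldivK.
by rewrite -[X in _ \\ X]rmul1 lmulK.
Qed.

Fact coset_rdiv x y :
  [set u / v | u in coset x & v in coset y] = coset (x / y).
Proof.
rewrite /coset; case: (nsubP A) => F [h ->].
apply/seteqP; split=> [_ [_ [a ha <-] [_ [b hb <-] <-]]|_ [c hc <-]] /=.
  exists ((x / y) \\ ((x * a) / (y * b))); last by rewrite ldivK.
  rewrite /= loop_morph_ldiv !loop_morph_rdiv !loop_morphM ha hb !rmul1.
  by rewrite -[X in _ \\ X]rmul1 lmulK.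
exists ((x / y * c) * y).
  exists (x \\ ((x / y * c) * y)); last by rewrite ldivK.
  rewrite /= loop_morph_ldiv !loop_morphM hc rmul1 -loop_morphM rdivK.
  by rewrite -[X in _ \\ X]rmul1 lmulK.
exists y; first by exists 1; [rewrite /= loop_morph1 | rewrite rmul1].
by rewrite rmulK.
Qed.

Definition quo_class (x : Q) : quotient :=
  exist _ (coset x) (mem_set (imageT coset x)).

Fact quo_closed (op : Q -> Q -> Q) :
  (forall x y, [set op u v | u in coset x & v in coset y] = coset (op x y)) ->
  forall X Y : quotient,
    [set op u v | u in val X & v in val Y] \in range coset.
Proof.
move=> opE [X /= /set_mem [x _ <-]] [Y /= /set_mem [y _ <-]].
by rewrite opE; apply/mem_set/imageT.
Qed.

Definition quo_one : quotient := quo_class 1.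
Definition quo_mul (X Y : quotient) : quotient :=
  exist _ [set u * v | u in val X & v in val Y] (quo_closed coset_mul X Y).
Definition quo_ldiv (X Y : quotient) : quotient :=
  exist _ [set u \\ v | u in val X & v in val Y] (quo_closed coset_ldiv X Y).
Definition quo_rdiv (X Y : quotient) : quotient :=
  exist _ [set u / v | u in val X & v in val Y] (quo_closed coset_rdiv X Y).

Fact coset1 : coset 1 = A.
Proof.
apply/seteqP; split=> [_ [a Aa <-]|a Aa]; first by rewrite lmul1.
by exists a; rewrite // lmul1.
Qed.

Fact quo_classP (X : quotient) : exists x, X = quo_class x.
Proof.
case: X => [X sX]; have [x _ defX] := set_mem sX.
by exists x; apply: val_inj; rewrite /= defX.
Qed.

HB.instance Definition _ := hasMul.Build quotient quo_mul.
HB.instance Definition _ := hasOne.Build quotient quo_one.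

Fact quo_mulE x y : quo_class x * quo_class y = quo_class (x * y).
Proof. by apply: val_inj; apply: coset_mul. Qed.
Fact quo_ldivE x y : quo_ldiv (quo_class x) (quo_class y) = quo_class (x \\ y).
Proof. by apply: val_inj; apply: coset_ldiv. Qed.
Fact quo_rdivE x y : quo_rdiv (quo_class x) (quo_class y) = quo_class (x / y).
Proof. by apply: val_inj; apply: coset_rdiv. Qed.

Fact quo_mull1 (X : quotient) : 1 * X = X.
Proof. by have [x ->] := quo_classP X; rewrite quo_mulE lmul1. Qed.
Fact quo_mulr1 (X : quotient) : X * 1 = X.
Proof. by have [x ->] := quo_classP X; rewrite quo_mulE rmul1. Qed.
Fact quo_mulKl (X : quotient) : cancel (fun Y => X * Y) (quo_ldiv X).
Proof.
move=> Y; have [x ->] := quo_classP X; have [y ->] := quo_classP Y.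
by rewrite quo_mulE quo_ldivE lmulK.
Qed.
Fact quo_ldivK (X : quotient) : cancel (quo_ldiv X) (fun Y => X * Y).
Proof.
move=> Y; have [x ->] := quo_classP X; have [y ->] := quo_classP Y.
by rewrite quo_ldivE quo_mulE ldivK.
Qed.
Fact quo_mulrK (X : quotient) : cancel (fun Y => Y * X) (quo_rdiv^~ X).
Proof.
move=> Y; have [x ->] := quo_classP X; have [y ->] := quo_classP Y.
by rewrite quo_mulE quo_rdivE rmulK.
Qed.
Fact quo_rdivK (X : quotient) : cancel (quo_rdiv^~ X) (fun Y => Y * X).
Proof.
move=> Y; have [x ->] := quo_classP X; have [y ->] := quo_classP Y.
by rewrite quo_rdivE quo_mulE rdivK.
Qed.

HB.instance Definition _ := BaseUMagma_isLoop.Build quotient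
  quo_mull1 quo_mulr1 quo_mulKl quo_ldivK quo_mulrK quo_rdivK.

End Quotient.

Section ProductLoop.
Variables (I : Type) (F : I -> loopType).

Definition prod_loop : Type := forall i, F i.

HB.instance Definition _ :=
  hasMul.Build prod_loop (fun f g i => f i * g i).
HB.instance Definition _ := hasOne.Build prod_loop (fun i => 1).

Fact prod_mull1 (f : prod_loop) : 1 * f = f.
Proof. by apply: functional_extensionality_dep => i; apply: lmul1. Qed.
Fact prod_mulr1 (f : prod_loop) : f * 1 = f.
Proof. by apply: functional_extensionality_dep => i; apply: rmul1. Qed.
Fact prod_mulKl (f : prod_loop) : cancel (fun g : prod_loop => f * g)
  (fun g i => f i \\ g i).
Proof. by move=> g; apply: functional_extensionality_dep => i; apply: lmulK. Qed.
Fact prod_ldivK (f : prod_loop) : cancel (fun g i => f i \\ g i)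
  (fun g : prod_loop => f * g).
Proof. by move=> g; apply: functional_extensionality_dep => i; apply: ldivK. Qed.
Fact prod_mulrK (f : prod_loop) : cancel (fun g : prod_loop => g * f)
  (fun g i => g i / f i).
Proof. by move=> g; apply: functional_extensionality_dep => i; apply: rmulK. Qed.
Fact prod_rdivK (f : prod_loop) : cancel (fun g i => g i / f i)
  (fun g : prod_loop => g * f).
Proof. by move=> g; apply: functional_extensionality_dep => i; apply: rdivK. Qed.

HB.instance Definition _ := @BaseUMagma_isLoop.Build prod_loop
  (fun f g i => f i \\ g i) (fun g f i => g i / f i)
  prod_mull1 prod_mulr1 prod_mulKl prod_ldivK prod_mulrK prod_rdivK.

End ProductLoop.

Section QuotientMap.
Variables (Q : loopType) (A : normalSubloop Q).

HB.instance Definition _ := isMultiplicative.Build Q (quotient A) (@quo_class Q A)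
  (fun x y => esym (quo_mulE A x y)).

Fact quo_class_ker : (@quo_class Q A) @^-1` [set 1] = A.
Proof.
apply/seteqP; split=> x /= => [xA | Ax].
  have : coset A x x by exists 1; [exact/set_mem/nsub1 | exact: rmul1].
  by move: (congr1 val xA) => /= ->; rewrite coset1.
apply: val_inj; rewrite /= coset1.
move: Ax; rewrite /coset; case: (nsubP A) => F [h ->] /= hx.
apply/seteqP; split=> y /=.
  by case=> a /= ha <-; rewrite loop_morphM hx ha rmul1.
move=> hy; exists (x \\ y); last exact: ldivK.
by rewrite /= loop_morph_ldiv hx hy -{2}(rmul1 1) lmulK.
Qed.

End QuotientMap.

(* Normal subloops are stable under intersection, so the [smallest] below is a
   normal subloop. *)
Fact smallest_normal (Q : loopType) (G : set Q) :
  is_normal (smallest (@is_normal Q) G).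
Proof.
pose I := {N : normalSubloop Q | G `<=` N}.
pose P := prod_loop (fun N : I => quotient (sval N)).
pose h (x : Q) : P := fun N => quo_class (sval N) x.
have hM : {morph h : x y / x * y}.
  by move=> x y; apply: functional_extensionality_dep => N; rewrite /h -quo_mulE.
pose hm := isMultiplicative.Build Q P h hM.
pose H : {multiplicative Q -> P} := HB.pack h hm.
exists P, H; apply/seteqP; split=> x /=.
  move=> xN; apply: functional_extensionality_dep => -[N GN].
  have Nx : (N : set Q) x by apply: xN; split=> //; exact: nsubP.
  by move: Nx; rewrite -(quo_class_ker N).
move=> hx N [normN GN].
have := congr1 (fun f : P => f (exist _ (NormalSubloop normN) GN)) hx.
by move=> /= e; rewrite -[N]/(nsub_set (NormalSubloop normN)) -quo_class_ker.
Qed.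

Section Commutator.
Variables (Q : loopType) (A B : normalSubloop Q).

Inductive comm_gen : set Q :=
| comm_gen_T a u v of A a & B (u / v) : comm_gen (Tin u a / Tin v a)
| comm_gen_U a u v of A a & B (u / v) : comm_gen (Uin u a / Uin v a)
| comm_gen_L a u1 u2 v1 v2 of A a & B (u1 / v1) & B (u2 / v2) :
    comm_gen (Lin u1 u2 a / Lin v1 v2 a)
| comm_gen_R a u1 u2 v1 v2 of A a & B (u1 / v1) & B (u2 / v2) :
    comm_gen (Rin u1 u2 a / Rin v1 v2 a)
| comm_gen_M a u1 u2 v1 v2 of A a & B (u1 / v1) & B (u2 / v2) :
    comm_gen (Min u1 u2 a / Min v1 v2 a).

Definition commutator : set Q := smallest (@is_normal Q) comm_gen.

End Commutator.

(* A loop is a commutative group iff its product is associative and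
   commutative: the identity and the inverses come with the loop structure. *)
Definition comm_group (L : loopType) : Prop :=
  associative (fun x y : L => x * y) /\ commutative (fun x y : L => x * y).

Definition zmod_of (L : loopType) (_ : comm_group L) : Type := L.

Section ZmodOf.
Variables (L : loopType) (hL : comm_group L).

Fact zmod_of_add0 : left_id (1 : L) (fun x y : L => x * y).
Proof. exact: lmul1. Qed.
Fact zmod_of_addN :
  left_inverse (1 : L) (fun x : L => x \\ 1) (fun x y : L => x * y).
Proof. by move=> x; rewrite hL.2 ldivK. Qed.

HB.instance Definition _ := gen_eqMixin (zmod_of hL).
HB.instance Definition _ := gen_choiceMixin (zmod_of hL).
HB.instance Definition _ := GRing.isZmodule.Build (zmod_of hL)
  hL.1 hL.2 zmod_of_add0 zmod_of_addN.

End ZmodOf.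

Record zmod_aut (V : zmodType) := ZmodAut {
  zmod_aut_perm :> permutation V;
  zmod_autD : {morph zmod_aut_perm : a b / (a + b)%R} }.

Record loop_cocycle (V : zmodType) (F : loopType) := LoopCocycle {
  cphi : F -> F -> zmod_aut V;
  cpsi : F -> F -> zmod_aut V;
  ctheta : F -> F -> V;
  cphi1 : forall y a, cphi y 1 a = a;
  cpsi1 : forall y a, cpsi 1 y a = a;
  ctheta1l : forall y, ctheta 1 y = 0%R;
  ctheta1r : forall y, ctheta y 1 = 0%R }.

Definition abelian_extension (V : zmodType) (F : loopType)
  (Gamma : loop_cocycle V F) : Type := (V * F)%type.

Section AbelianExtension.
Variables (V : zmodType) (F : loopType) (G : loop_cocycle V F).
Local Notation E := (abelian_extension G).

Definition ext_one : E := (0%R, 1).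
Definition ext_mul (p q : E) : E :=
  ((cphi G p.2 q.2 p.1 + cpsi G p.2 q.2 q.1 + ctheta G p.2 q.2)%R, p.2 * q.2).
Definition ext_ldiv (p r : E) : E :=
  let y := p.2 \\ r.2 in
  (perm_inv (cpsi G p.2 y) (r.1 - ctheta G p.2 y - cphi G p.2 y p.1)%R, y).
Definition ext_rdiv (r q : E) : E :=
  let x := r.2 / q.2 in
  (perm_inv (cphi G x q.2) (r.1 - ctheta G x q.2 - cpsi G x q.2 q.1)%R, x).

HB.instance Definition _ := hasMul.Build E ext_mul.
HB.instance Definition _ := hasOne.Build E ext_one.

Fact zmod_aut0 (s : zmod_aut V) : s 0%R = 0%R.
Proof. by apply: (addrI (s 0%R)); rewrite -zmod_autD !addr0. Qed.

Fact ext_mull1 (x : E) : 1 * x = x.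
Proof.
case: x => a x; rewrite [LHS]/(ext_mul _ _) /ext_mul /=.
by rewrite zmod_aut0 cpsi1 ctheta1l add0r addr0 lmul1.
Qed.
Fact ext_mulr1 (x : E) : x * 1 = x.
Proof.
case: x => a x; rewrite [LHS]/(ext_mul _ _) /ext_mul /=.
by rewrite zmod_aut0 cphi1 ctheta1r !addr0 rmul1.
Qed.
Fact ext_mulKl (x : E) : cancel (fun y => x * y) (ext_ldiv x).
Proof.
case: x => a x [b y]; rewrite /ext_ldiv /= lmulK addrK.
by rewrite [X in (X - _)%R]addrC addrK perm_funK.
Qed.
Fact ext_ldivK (x : E) : cancel (ext_ldiv x) (fun y => x * y).
Proof.
case: x => a x [c z]; rewrite [LHS]/(ext_mul _ _) /ext_mul /=.
by rewrite perm_invK ldivK addrC [X in (_ + X)%R]addrC subrK addrC subrK.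
Qed.
Fact ext_mulrK (x : E) : cancel (fun y => y * x) (ext_rdiv^~ x).
Proof.
case: x => b y [a x]; rewrite /ext_rdiv /= rmulK addrK.
by rewrite addrK perm_funK.
Qed.
Fact ext_rdivK (x : E) : cancel (ext_rdiv^~ x) (fun y => y * x).
Proof.
case: x => b y [c z]; rewrite [LHS]/(ext_mul _ _) /ext_mul /=.
by rewrite perm_invK rdivK subrK subrK.
Qed.

HB.instance Definition _ := BaseUMagma_isLoop.Build E
  ext_mull1 ext_mulr1 ext_mulKl ext_ldivK ext_mulrK ext_rdivK.

End AbelianExtension.

Section Conditions.
Variables (Q : loopType) (A : normalSubloop Q).

Definition abelian_in : Prop := commutator A A = [set 1].

Definition inner_words_agree : Prop :=
  forall (n : nat) (W : word n), inner_word W ->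
  forall u v : 'I_n -> Q, (forall i, A (u i / v i)) ->
  forall a, A a -> (word_eval u W * (word_eval v W)^-1) a = a.

Definition inner_aut_and_identities : Prop :=
  [/\ forall p, Inn p ->
        set_bij A A p /\
        (forall a b, A a -> A b -> p (a * b) = p a * p b),
      forall a b x, A a -> A b ->
        [/\ loop_comm a b = 1, loop_assoc a b x = 1,
            loop_assoc a x b = 1 & loop_assoc x a b = 1] &
      forall a x u v, A a -> A (u / v) -> loop_assoc a x u = loop_assoc a x v].

Definition is_abelian_extension : Prop :=
  exists (hA : comm_group (subloop A))
         (Gamma : loop_cocycle (zmod_of hA) (quotient A))
         (f : {multiplicative abelian_extension Gamma -> Q}),
    [/\ bijective f,
        forall a : subloop A, f (a, 1) = val a &
        forall (a : subloop A) (X : quotient A), val X (f (a, X))].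

End Conditions.

(* Main.v *)
(* Each condition is compared with one statement about cosets of [A]: [A] is a
   commutative group acting on its cosets by left multiplication, and the product
   of two cosets is affine for these actions, that is, (ax)(by) = f(a)g(b)(xy)
   with automorphisms f, g of [A] that depend only on the cosets of x and y.
   Under (A1)-(A3) one can take f = R_{y,x} and g = T_{xy} L_{x,y} T_y^{-1}; the
   maps U and M are not needed. Conversely, if the product is affine, then
   translations by congruent elements are affine on each coset with the same
   linear part, and so are inverses and composites of such maps; those that fix 1
   thus agree on [A] and restrict to automorphisms. *)

From HB Require Import structures.
Require Import Defs.
From mathcomp Require Import all_boot ssralg.
From mathcomp Require Import boolp classical_sets.

Set Implicit Arguments.
Unset Strict Implicit.
Unset Printing Implicit Defensive.

Import GRing.Theory.

Local Open Scope classical_set_scope.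
Local Open Scope group_scope.

Local Notation "x \\ y" := (ldiv x y)
  (at level 40, left associativity) : group_scope.
Local Notation "x / y" := (rdiv x y) : group_scope.

(** * Cancellation laws and the standard inner mappings *)

Section LoopCancellation.
Variable Q : loopType.
Implicit Types x y z : Q.

Lemma lmulI z : injective (fun x => z * x).
Proof. exact: can_inj (lmulK z). Qed.

Lemma rmulI z : injective (fun x => x * z).
Proof. exact: can_inj (rmulK z). Qed.

Lemma rdivxx x : x / x = 1.
Proof. by rewrite -{1}(lmul1 x) rmulK. Qed.

Lemma ldivxx x : x \\ x = 1.
Proof. by rewrite -{2}(rmul1 x) lmulK. Qed.

Lemma rdivx1 x : x / 1 = x.
Proof. by rewrite -{1}(rmul1 x) rmulK. Qed.

Lemma ldiv1x x : 1 \\ x = x.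
Proof. by rewrite -{1}(lmul1 x) lmulK. Qed.

Lemma rdiv_eq1 x y : x / y = 1 -> x = y.
Proof. by move=> e; rewrite -(rdivK y x) /= e lmul1. Qed.

Lemma TinE x y : Tin x y * x = x * y.
Proof. exact: rdivK. Qed.

Lemma LinE x y z : x * y * Lin x y z = x * (y * z).
Proof. exact: ldivK. Qed.

Lemma RinE x y z : Rin x y z * (y * x) = z * y * x.
Proof. exact: rdivK. Qed.

Lemma Tin1 x : Tin x 1 = 1.
Proof. by rewrite /= rmul1 rdivxx. Qed.

Lemma Uin1 x : Uin x 1 = 1.
Proof. by rewrite /= ldiv1x rdivxx. Qed.

Lemma Lin1 x y : Lin x y 1 = 1.
Proof. by rewrite /= rmul1 ldivxx. Qed.

Lemma Rin1 x y : Rin x y 1 = 1.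
Proof. by rewrite /= lmul1 rdivxx. Qed.

Lemma Min1 x y : Min x y 1 = 1.
Proof. by rewrite /= ldiv1x rdivxx. Qed.

Lemma Inn_Tin x : Inn (Tin x).
Proof.
split; last exact: Tin1.
by apply: Mlt_mul; [apply/Mlt_inv/Mlt_rtrans | apply: Mlt_ltrans].
Qed.

Lemma Inn_Lin x y : Inn (Lin x y).
Proof.
split; last exact: Lin1.
by apply: Mlt_mul; [apply/Mlt_inv/Mlt_ltrans | apply: Mlt_mul; apply: Mlt_ltrans].
Qed.

Lemma Inn_Rin x y : Inn (Rin x y).
Proof.
split; last exact: Rin1.
by apply: Mlt_mul; [apply/Mlt_inv/Mlt_rtrans | apply: Mlt_mul; apply: Mlt_rtrans].
Qed.

End LoopCancellation.

(** * Loop automorphisms as multiplicative permutations *)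

Section Automorphisms.
Variable L : loopType.

Definition is_aut (s : permutation L) : Prop := {morph s : a b / a * b}.

Lemma is_aut_mul s t : is_aut s -> is_aut t -> is_aut (s * t).
Proof. by move=> sM tM a b; rewrite /= tM sM. Qed.

Lemma is_aut_inv s : is_aut s -> is_aut s^-1.
Proof.
by move=> sM a b; apply: (can_inj (perm_funK s)); rewrite sM !perm_invK.
Qed.

Lemma is_aut1 s : is_aut s -> s 1 = 1.
Proof. by move=> sM; apply: (@lmulI _ (s 1)); rewrite -sM !rmul1. Qed.

End Automorphisms.

(** * Congruence modulo [A] and restriction of maps to [A] *)

Section Cosets.
Variables (Q : loopType) (A : normalSubloop Q).
Local Notation cl := (@quo_class Q A).
Implicit Types (x y : Q) (a b : subloop A).

Lemma quo_classM x y : cl (x * y) = cl x * cl y.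
Proof. by rewrite quo_mulE. Qed.

Lemma quo_class_ldiv x y : cl (x \\ y) = cl x \\ cl y.
Proof. by rewrite -quo_ldivE. Qed.

Lemma quo_class_rdiv x y : cl (x / y) = cl x / cl y.
Proof. by rewrite -quo_rdivE. Qed.

Lemma quo_class1 : cl 1 = 1.
Proof. by []. Qed.

Lemma quo_class_eq1 x : (cl x = 1) <-> A x.
Proof. by rewrite -[X in _ <-> X x](quo_class_ker A). Qed.

Lemma quo_class_val a : cl (val a) = 1.
Proof. exact/quo_class_eq1/set_mem/valP. Qed.

Lemma quo_class_valM a x : cl (val a * x) = cl x.
Proof. by rewrite quo_classM quo_class_val lmul1. Qed.

Definition to_subloop x (Ax : A x) : subloop A := exist _ x (mem_set Ax).

Lemma rdiv_quo_class u v : A (u / v) <-> cl u = cl v.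
Proof.
rewrite -quo_class_eq1 quo_class_rdiv; split=> [/rdiv_eq1 //|->].
exact: rdivxx.
Qed.

Lemma quo_class_eqP x y : cl x = cl y -> exists a, x = val a * y.
Proof. by move=> /rdiv_quo_class Axy; exists (to_subloop Axy); rewrite /= rdivK. Qed.

Lemma val_quotient x (X : quotient A) : cl x = X -> val X x.
Proof. by move=> <-; exists 1; [apply/set_mem/nsub1 | rewrite rmul1]. Qed.

Section Restriction.
Variables (p : permutation Q) (stabA : forall x, A (p x) <-> A x).

Fact stab_inv x : A x -> A (perm_inv p x).
Proof. by move=> Ax; apply/stabA; rewrite perm_invK. Qed.

Definition restr_fun a : subloop A :=
  to_subloop (proj2 (stabA (val a)) (set_mem (valP a))).
Definition restr_inv a : subloop A := to_subloop (stab_inv (set_mem (valP a))).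

Fact restr_funK : cancel restr_fun restr_inv.
Proof. by move=> a; apply: val_inj; apply: perm_funK. Qed.
Fact restr_invK : cancel restr_inv restr_fun.
Proof. by move=> a; apply: val_inj; apply: perm_invK. Qed.

(** Stability of [A] is assumed in both directions, because an injective self-map of an infinite [A]
    need not be onto. *)
Definition restr := Permutation restr_funK restr_invK.

Lemma is_aut_restr :
  (forall x y, A x -> A y -> p (x * y) = p x * p y) -> is_aut restr.
Proof. by move=> pM a b; apply: val_inj; apply: pM; apply/set_mem/valP. Qed.

End Restriction.

(** The identity [TinE] is projected to the quotient, where membership in [A] means class 1, and
    [cl x] is cancelled. The same argument serves for L and R. *)
Lemma stab_Tin x y : A (Tin x y) <-> A y.
Proof.
rewrite -!quo_class_eq1; have := congr1 cl (TinE x y); rewrite !quo_classM => e.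
split=> y1; first by apply: (@lmulI _ (cl x)); rewrite -e y1 lmul1 rmul1.
by apply: (@rmulI _ (cl x)); rewrite e y1 lmul1 rmul1.
Qed.

Lemma stab_Lin x y z : A (Lin x y z) <-> A z.
Proof.
rewrite -!quo_class_eq1; have := congr1 cl (LinE x y z); rewrite !quo_classM => e.
split=> z1; last by apply: (@lmulI _ (cl x * cl y)); rewrite e z1 !rmul1.
apply: (@lmulI _ (cl y)); apply: (@lmulI _ (cl x)).
by rewrite -e z1 !rmul1.
Qed.

Lemma stab_Rin x y z : A (Rin x y z) <-> A z.
Proof.
rewrite -!quo_class_eq1; have := congr1 cl (RinE x y z); rewrite !quo_classM => e.
split=> z1; last by apply: (@rmulI _ (cl y * cl x)); rewrite e z1 !lmul1.
apply: (@rmulI _ (cl y)); apply: (@rmulI _ (cl x)).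
by rewrite -e z1 !lmul1.
Qed.

End Cosets.

(** * Affine multiplication of cosets *)

Section AffineMultiplication.
Variables (Q : loopType) (A : normalSubloop Q).
Local Notation cl := (@quo_class Q A).
Implicit Types (x y : Q) (a b c : subloop A).

(* [A] acts on each of its cosets by left multiplication, and the product of two
   cosets is affine, with linear part [f a * g b], for these actions. *)
Definition affine_mul : Prop :=
  [/\ forall a b, a * b = b * a,
      forall a b x, val (a * b) * x = val a * (val b * x) &
      forall x y, exists f g : permutation (subloop A), [/\ is_aut f, is_aut g &
        forall a b,
          (val a * x) * (val b * y) = val (f a) * (val (g b) * (x * y))]].

(** The common consequence of (A1) and (A2) from which affine multiplication is derived. *)
Definition inner_maps_agree : Prop :=
  [/\ forall a u v, cl u = cl v -> Tin u (val a) = Tin v (val a),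
      forall a u1 u2 v1 v2, cl u1 = cl v1 -> cl u2 = cl v2 ->
        Lin u1 u2 (val a) = Lin v1 v2 (val a) &
      forall a u1 u2 v1 v2, cl u1 = cl v1 -> cl u2 = cl v2 ->
        Rin u1 u2 (val a) = Rin v1 v2 (val a)].

(** Both factors from [A] are moved to the left of xy. First (ax)(by) = R_{by,x}(a) (x(by)), and
    R_{by,x} agrees with R_{y,x} on [A]. Then, with b = T_y(c), x(by) = x(yc) = (xy) L_{x,y}(c) =
    T_{xy}(L_{x,y}(c)) (xy). *)
Lemma affine_mulP :
    (forall a b, a * b = b * a) ->
    (forall a b x, val (a * b) * x = val a * (val b * x)) ->
    (forall a x u v, cl u = cl v -> Rin u x (val a) = Rin v x (val a)) ->
    (forall x, is_aut (restr (@stab_Tin Q A x))) ->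
    (forall x y, is_aut (restr (@stab_Lin Q A x y))) ->
    (forall x y, is_aut (restr (@stab_Rin Q A x y))) ->
  affine_mul.
Proof.
move=> mulC mulA RinA autT autL autR; split=> // x y.
exists (restr (@stab_Rin Q A y x)).
exists (restr (@stab_Tin Q A (x * y)) * (restr (@stab_Lin Q A x y)
          * (restr (@stab_Tin Q A y))^-1)).
split=> //.
  by apply: is_aut_mul => //; apply: is_aut_mul => //; apply: is_aut_inv.
move=> a b.
have -> : val (restr (@stab_Rin Q A y x) a) = Rin (val b * y) x (val a).
  by apply: RinA; rewrite quo_class_valM.
rewrite -RinE; congr (_ * _).
set c := (restr (@stab_Tin Q A y))^-1 b.
have <- : Tin y (val c) = val b.
  exact: (congr1 val (perm_invK (restr (@stab_Tin Q A y)) b)).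
by rewrite TinE -LinE -TinE.
Qed.

(** An element of [A] used as a parameter may be replaced by 1, which turns T_a, R_{x,b}, R_{b,x}
    and L_{x,a} into the identity on [A]. This gives commutativity and the associative laws with two
    factors in [A]; these laws then make the inner mappings multiplicative on [A]. *)
Lemma inner_maps_agree_affine : inner_maps_agree -> affine_mul.
Proof.
case=> agT agL agR.
have cl1 a : cl (val a) = cl 1 by rewrite quo_class_val.
have mulC a b : a * b = b * a.
  apply: val_inj; rewrite /= -[LHS]TinE (agT b _ _ (cl1 a)).
  by rewrite /= lmul1 rdivx1.
have mulA a b x : val (a * b) * x = val a * (val b * x).
  rewrite -[LHS]RinE (agR a _ _ _ _ (erefl (cl x)) (cl1 b)).
  by rewrite /= rmul1 lmul1 rmulK.
have mulxA x a b : x * val (a * b) = x * val a * val b.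
  rewrite -[LHS]LinE (agL b _ _ _ _ (erefl (cl x)) (cl1 a)).
  by rewrite /= lmul1 rmul1 lmulK.
have mulAx a x b : val a * x * val b = val a * (x * val b).
  rewrite -[LHS]RinE (agR a _ _ _ _ (cl1 b) (erefl (cl x))).
  by rewrite /= !rmul1 rmulK.
apply: affine_mulP => //.
- by move=> a x u v uv; apply: agR.
(* Both sides times x equal (xa)b: T_x(a)(T_x(b)x) = T_x(a)(xb) = (T_x(a)x)b. *)
- move=> x a b; apply: val_inj; apply: (@rmulI _ x).
  rewrite [LHS]TinE mulxA mulA [val (restr _ b) * _]TinE -mulAx.
  by rewrite [val (restr _ a) * _]TinE.
(* After multiplication by xy, the two sides are (x(ya)) L_{x,ya}(b) and (x(ya)) L_{x,y}(b), and ya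
   is congruent to y. *)
- move=> x y a b; apply: val_inj; apply: (@lmulI _ (x * y)).
  rewrite [LHS]LinE mulxA -LinE mulxA [_ * val (restr _ a)]LinE; congr (_ * _).
  by apply: agL => //; rewrite quo_classM quo_class_val rmul1.
- move=> y x a b; apply: val_inj; apply: (@rmulI _ (x * y)).
  rewrite [LHS]RinE mulA -RinE mulA [val (restr _ b) * _]RinE; congr (_ * _).
  by apply: agR => //; rewrite quo_class_valM.
Qed.

(** * Affine multiplication from each of the four conditions *)

Lemma commutator_inner_maps : abelian_in A -> inner_maps_agree.
Proof.
move=> comm1.
have gen1 : comm_gen A A `<=` [set 1] by rewrite -comm1; apply: sub_gen_smallest.
have inA a : A (val a) by apply/set_mem/valP.
split=> [a u v /rdiv_quo_class uv|a u1 u2 v1 v2|a u1 u2 v1 v2].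
- exact/rdiv_eq1/gen1/comm_gen_T.
- by move=> /rdiv_quo_class uv1 /rdiv_quo_class uv2; exact/rdiv_eq1/gen1/comm_gen_L.
- by move=> /rdiv_quo_class uv1 /rdiv_quo_class uv2; exact/rdiv_eq1/gen1/comm_gen_R.
Qed.

Lemma inner_words_inner_maps : inner_words_agree A -> inner_maps_agree.
Proof.
move=> agW.
have ag n (W : word n) : inner_word W -> forall u v : 'I_n -> Q,
    (forall i, cl (u i) = cl (v i)) -> forall a, A (word_eval v W (val a)) ->
    word_eval u W (val a) = word_eval v W (val a).
  move=> innW u v uv a Wa.
  (* Since (A2) involves the inverse of W_v, it is applied at the point W_v(a), which must therefore
     lie in [A]. *)
  have {Wa} := agW n W innW u v (fun i => proj2 (rdiv_quo_class _ _ _) (uv i)) _ Wa.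
  by rewrite [LHS]/(word_eval u W (perm_inv _ _)) perm_funK.
have inA a : A (val a) by apply/set_mem/valP.
pose pair (x y : Q) (i : 'I_2) := if i == ord0 then x else y.
pose t0 : loop_term 2 := TVar ord0; pose t1 : loop_term 2 := TVar ord_max.
have pairP u1 u2 v1 v2 : cl u1 = cl v1 -> cl u2 = cl v2 ->
    forall i, cl (pair u1 u2 i) = cl (pair v1 v2 i).
  by move=> e1 e2 i; rewrite /pair; case: ifP.
split=> [a u v uv|a u1 u2 v1 v2 e1 e2|a u1 u2 v1 v2 e1 e2].
- pose W : word 1 := [:: LetRinv (TVar ord0); LetL (TVar ord0)].
  have WE (L : loopType) (w : 'I_1 -> L) : word_eval w W = Tin (w ord0).
    by rewrite /word_eval !big_cons big_nil; apply: permutation_eq.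
  have := ag 1%N W _ (fun=> u) (fun=> v) (fun=> uv) a; rewrite !WE; apply.
    by move=> L w; rewrite WE Tin1.
  exact/stab_Tin.
- pose W : word 2 := [:: LetLinv (TMul t0 t1); LetL t0; LetL t1].
  have WE (L : loopType) (w : 'I_2 -> L) :
      word_eval w W = Lin (w ord0) (w ord_max).
    by rewrite /word_eval !big_cons big_nil; apply: permutation_eq.
  have := ag 2%N W _ _ _ (pairP _ _ _ _ e1 e2) a; rewrite !WE; apply.
    by move=> L w; rewrite WE Lin1.
  exact/stab_Lin.
- pose W : word 2 := [:: LetRinv (TMul t1 t0); LetR t0; LetR t1].
  have WE (L : loopType) (w : 'I_2 -> L) :
      word_eval w W = Rin (w ord0) (w ord_max).
    by rewrite /word_eval !big_cons big_nil; apply: permutation_eq.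
  have := ag 2%N W _ _ _ (pairP _ _ _ _ e1 e2) a; rewrite !WE; apply.
    by move=> L w; rewrite WE Rin1.
  exact/stab_Rin.
Qed.

Lemma inner_aut_affine : inner_aut_and_identities A -> affine_mul.
Proof.
case=> inn_aut ids idR.
have inA a : A (val a) by apply/set_mem/valP.
apply: affine_mulP.
- move=> a b; apply: val_inj; have [/rdiv_eq1 ab _ _ _] := ids _ _ 1 (inA a) (inA b).
  by rewrite /= -[LHS]TinE ab.
- move=> a b x; have [_ /rdiv_eq1 abx _ _] := ids _ _ x (inA a) (inA b).
  by rewrite -[LHS]RinE abx.
(* Here [a,x,u] = R_{u,x}(a)/a, so equal associators give equal values of R after cancelling a. *)
- by move=> a x u v /rdiv_quo_class uv; apply: (can_inj (rdivK (val a))); apply: idR.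
- by move=> x; apply: is_aut_restr; apply: (inn_aut _ (Inn_Tin x)).2.
- by move=> x y; apply: is_aut_restr; apply: (inn_aut _ (Inn_Lin x y)).2.
- by move=> x y; apply: is_aut_restr; apply: (inn_aut _ (Inn_Rin x y)).2.
Qed.

Lemma abelian_extension_affine : is_abelian_extension A -> affine_mul.
Proof.
case=> hA [G [f [bijf f1 _]]].
have [f' fK f'K] := bijf.
(* Left multiplication by [A] is translation in the first coordinate only up to the automorphism
   phi_{1,Z}, which may be nontrivial; this explains the conjugating factors in the two witnesses
   below. *)
have actE a z Z : val a * f (z, Z) = f ((cphi G 1%g Z a + z)%R, Z).
  rewrite -f1 -gmulfM; congr (f _); rewrite [LHS]/(ext_mul _ _) /ext_mul /=.
  by rewrite cpsi1 ctheta1l addr0 lmul1.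
split=> [||x y]; first exact: hA.2.
  move=> a b x; rewrite -(f'K x); case: (f' x) => c X.
  rewrite !actE; congr (f (_, _)).
  by rewrite [cphi G 1 X (a * b)](zmod_autD (cphi G 1 X) a b) addrA.
rewrite -(f'K x) -(f'K y); case: (f' x) (f' y) => [c X] [d Y].
have autc (s : zmod_aut (zmod_of hA)) : @is_aut (subloop A) s.
  by move=> a b; apply: (zmod_autD s).
exists ((cphi G 1 (X * Y) : permutation _)^-1
          * ((cphi G X Y : permutation _) * cphi G 1 X)).
exists ((cphi G 1 (X * Y) : permutation _)^-1
          * ((cpsi G X Y : permutation _) * cphi G 1 Y)).
split.
- by apply: (@is_aut_mul (subloop A));
    [apply: (@is_aut_inv (subloop A)) | apply: (@is_aut_mul (subloop A))].
- by apply: (@is_aut_mul (subloop A));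
    [apply: (@is_aut_inv (subloop A)) | apply: (@is_aut_mul (subloop A))].
move=> a b; rewrite !actE -!gmulfM.
rewrite [X in val _ * (val _ * f X)]/(ext_mul _ _) [in LHS]/(_ * _) /=.
rewrite /ext_mul /= !actE; congr (f (_, _)).
rewrite !perm_invK !zmod_autD -!addrA; congr (_ + _)%R.
by rewrite addrCA.
Qed.

End AffineMultiplication.

(** * Parallel permutations and their closure properties *)

Section ParallelMaps.
Variables (Q : loopType) (A : normalSubloop Q).
Local Notation cl := (@quo_class Q A).
Implicit Types (x y : Q) (a b : subloop A) (p q : permutation Q).

Hypothesis affA : affine_mul A.

(** Replacing x, y by cx, dy only inserts the factors f(c) and g(d), which commutativity and
    associativity absorb into the new product; so one pair f, g serves for whole cosets. *)
Lemma affine_mul_coset x y :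
  exists f g : permutation (subloop A), [/\ is_aut f, is_aut g &
    forall x' y', cl x' = cl x -> cl y' = cl y -> forall a b,
      (val a * x') * (val b * y') = val (f a) * (val (g b) * (x' * y'))].
Proof.
case: affA => mulC mulA affM.
have [f [g [fM gM fgE]]] := affM x y; exists f, g; split=> //.
move=> _ _ /quo_class_eqP[c ->] /quo_class_eqP[d ->] a b.
rewrite -!mulA !fgE fM gM !mulA; congr (_ * _).
by rewrite -!mulA [f c * _]mulC.
Qed.

(* [p] and [q] induce the same map on the quotient, and on each coset of [A]
   they are affine with the same linear part. *)
Definition parallel p q : Prop :=
  forall x, cl (p x) = cl (q x) /\
    exists2 s : permutation (subloop A), is_aut s &
      forall y, cl y = cl x -> forall a,
        p (val a * y) = val (s a) * p y /\ q (val a * y) = val (s a) * q y.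

Lemma parallel1 : parallel 1 1.
Proof. by move=> x; split=> //; exists 1. Qed.

Lemma parallel_cl p q x y : parallel p q -> cl x = cl y -> cl (p x) = cl (q y).
Proof.
move=> pq /quo_class_eqP[a ->]; have [<- [s _ sE]] := pq y.
by have [-> _] := sE y erefl a; rewrite quo_class_valM.
Qed.

Lemma parallel_sym p q : parallel p q -> parallel q p.
Proof.
move=> pq x; have [e [s sM sE]] := pq x; split=> //.
by exists s => // y yx a; have [] := sE y yx a.
Qed.

(** Linear parts are onto [A], so [q] maps the coset of x onto the whole coset of [q x]; injectivity
    of [q] then puts y in the coset of x. *)
Lemma parallel_cl_inv p q x y :
  parallel p q -> cl (p x) = cl (q y) -> cl x = cl y.
Proof.
move=> pq; have [-> [s _ sE]] := pq x => /esym/quo_class_eqP[b yb].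
have [_] := sE x erefl (perm_inv s b).
by rewrite perm_invK -yb => /(can_inj (perm_funK q)) <-; rewrite quo_class_valM.
Qed.

Lemma parallel_mul p q p' q' :
  parallel p q -> parallel p' q' -> parallel (p * p') (q * q').
Proof.
move=> pq pq' x; have [e [s sM sE]] := pq' x; have [_ [t tM tE]] := pq (p' x).
split; first exact: (parallel_cl pq e).
exists (t * s); first exact: is_aut_mul.
move=> y yx a; have [/= -> ->] := sE y yx a.
have pp : cl (p' y) = cl (p' x).
  by rewrite e; apply: (parallel_cl pq').
have qp : cl (q' y) = cl (p' x).
  by apply: (parallel_cl (parallel_sym pq')).
by split; [have [] := tE _ pp (s a) | have [] := tE _ qp (s a)].
Qed.

Lemma parallel_inv p q : parallel p q -> parallel p^-1 q^-1.
Proof.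
move=> pq x.
have invE y z : cl y = cl z -> cl (perm_inv p y) = cl (perm_inv q z).
  by move=> yz; apply: (parallel_cl_inv pq); rewrite !perm_invK.
split; first exact: invE.
have [_ [s sM sE]] := pq (perm_inv p x).
exists s^-1; first exact: is_aut_inv.
move=> y yx a.
have pp : cl (perm_inv p y) = cl (perm_inv p x) by rewrite (invE y x) // (invE x x).
have qp : cl (perm_inv q y) = cl (perm_inv p x) by rewrite (invE x y).
split.
  apply: (can_inj (perm_funK p)); have [-> _] := sE _ pp (perm_inv s a).
  by rewrite /= !perm_invK.
apply: (can_inj (perm_funK q)); have [_ ->] := sE _ qp (perm_inv s a).
by rewrite /= !perm_invK.
Qed.

(** * Translations, inner mappings and words with congruent parameters *)

Lemma parallel_ltrans u v : cl u = cl v -> parallel (ltrans u) (ltrans v).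
Proof.
move=> uv x; split; first by rewrite /= !quo_classM uv.
have [f [g [fM gM fgE]]] := affine_mul_coset u x; exists g => // y yx a.
have E w : cl w = cl u -> w * (val a * y) = val (g a) * (w * y).
  move=> wu; have := fgE w y wu yx 1 a.
  by rewrite is_aut1 // !lmul1.
by split; apply: E.
Qed.

Lemma parallel_rtrans u v : cl u = cl v -> parallel (rtrans u) (rtrans v).
Proof.
move=> uv x; split; first by rewrite /= !quo_classM uv.
have [f [g [fM gM fgE]]] := affine_mul_coset x u; exists f => // y yx a.
have E w : cl w = cl u -> val a * y * w = val (f a) * (y * w).
  move=> wu; have := fgE y w yx wu a 1.
  by rewrite is_aut1 // !lmul1.
by split; apply: E.
Qed.

Lemma parallel_mtrans u v : cl u = cl v -> parallel (mtrans u) (mtrans v).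
Proof.
move=> uv x; split; first by rewrite /= !quo_class_ldiv uv.
have [mulC mulA _] := affA.
have mulA' a b c : a * b * c = a * (b * c).
  by apply: val_inj; exact: mulA.
have [f [g [fM gM fgE]]] := affine_mul_coset x (x \\ u).
(* This is inversion in [A], an automorphism because [A] is a commutative group. The linear part
   comes from solving (ay)(c(y\w)) = f(a)g(c)w = w for c. *)
pose inv := mtrans (1 : subloop A).
exists (g^-1 * (inv * f)).
  apply: is_aut_mul; first exact: is_aut_inv.
  apply: is_aut_mul => // a b; apply: (@lmulI _ (a * b)).
  have mulV c : c * inv c = 1 by exact: ldivK.
  rewrite mulV [a * b]mulC mulA' -[a * (_ * _)]mulA' mulV.
  by rewrite -[1 * _]/(1 * inv b) lmul1 mulV.
move=> y yx a.
have E w : cl w = cl u ->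
    (val a * y) \\ w = val ((g^-1 * (inv * f)) a) * (y \\ w).
  move=> wu; apply: (@lmulI _ (val a * y)); rewrite ldivK fgE //; last first.
    by rewrite !quo_class_ldiv yx wu.
  rewrite ldivK [g _]perm_invK -mulA.
  have -> : f a * inv (f a) = 1 by exact: ldivK.
  by rewrite lmul1.
by split; apply: E.
Qed.

(** On the coset [A] of 1, both maps reduce to their common linear part. *)
Lemma parallel_fix1 p q :
  parallel p q -> p 1 = 1 -> q 1 = 1 -> forall a, p (val a) = q (val a).
Proof.
move=> pq p1 q1 a; have [_ [s _ sE]] := pq 1.
by have [] := sE 1 erefl a; rewrite p1 q1 !rmul1 => -> ->.
Qed.

Lemma parallel_Tin u v : cl u = cl v -> parallel (Tin u) (Tin v).
Proof.
move=> uv; apply: parallel_mul; last exact: parallel_ltrans.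
exact/parallel_inv/parallel_rtrans.
Qed.

Lemma parallel_Uin u v : cl u = cl v -> parallel (Uin u) (Uin v).
Proof.
move=> uv; apply: parallel_mul; last exact: parallel_mtrans.
exact/parallel_inv/parallel_rtrans.
Qed.

Lemma parallel_Lin u1 u2 v1 v2 :
  cl u1 = cl v1 -> cl u2 = cl v2 -> parallel (Lin u1 u2) (Lin v1 v2).
Proof.
move=> e1 e2; apply: parallel_mul; last first.
  by apply: parallel_mul; apply: parallel_ltrans.
by apply/parallel_inv/parallel_ltrans; rewrite !quo_classM e1 e2.
Qed.

Lemma parallel_Rin u1 u2 v1 v2 :
  cl u1 = cl v1 -> cl u2 = cl v2 -> parallel (Rin u1 u2) (Rin v1 v2).
Proof.
move=> e1 e2; apply: parallel_mul; last first.
  by apply: parallel_mul; apply: parallel_rtrans.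
by apply/parallel_inv/parallel_rtrans; rewrite !quo_classM e1 e2.
Qed.

Lemma parallel_Min u1 u2 v1 v2 :
  cl u1 = cl v1 -> cl u2 = cl v2 -> parallel (Min u1 u2) (Min v1 v2).
Proof.
move=> e1 e2; apply: parallel_mul; last first.
  by apply: parallel_mul; apply: parallel_mtrans.
by apply/parallel_inv/parallel_mtrans; rewrite !quo_class_ldiv e1 e2.
Qed.

(** Being parallel to itself means being affine on every coset of [A]. *)
Lemma parallel_Mlt p : Mlt p -> parallel p p.
Proof.
elim=> [x|x||p1 p2 _ P1 _ P2|p1 _ P1].
- exact: parallel_ltrans.
- exact: parallel_rtrans.
- exact: parallel1.
- exact: parallel_mul.
- exact: parallel_inv.
Qed.

Lemma term_eval_cl n (t : loop_term n) (u v : 'I_n -> Q) :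
  (forall i, cl (u i) = cl (v i)) -> cl (term_eval u t) = cl (term_eval v t).
Proof.
move=> uv; elim: t => [i||s IHs t IHt|s IHs t IHt|s IHs t IHt] //=.
- by rewrite !quo_classM IHs IHt.
- by rewrite !quo_class_ldiv IHs IHt.
- by rewrite !quo_class_rdiv IHs IHt.
Qed.

Lemma parallel_word n (W : word n) (u v : 'I_n -> Q) :
  (forall i, cl (u i) = cl (v i)) -> parallel (word_eval u W) (word_eval v W).
Proof.
move=> uv; elim: W => [|l W IHW].
  by rewrite /word_eval !big_nil; apply: parallel1.
rewrite /word_eval !big_cons; apply: parallel_mul => //.
case: l => t /=; try apply: parallel_inv;
  by [apply/parallel_ltrans/term_eval_cl | apply/parallel_rtrans/term_eval_cl].
Qed.

(** * The four conditions from affine multiplication *)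

Lemma affine_abelian : abelian_in A.
Proof.
have gen1 : comm_gen A A `<=` [set 1].
  have fixE p q x : A x -> parallel p q -> p 1 = 1 -> q 1 = 1 ->
      p x / q x = 1.
    move=> Ax pq p1 q1; rewrite -[x]/(val (to_subloop Ax)).
    by rewrite (parallel_fix1 pq p1 q1) rdivxx.
  move=> _ [a u v Aa|a u v Aa|a u1 u2 v1 v2 Aa|a u1 u2 v1 v2 Aa|a u1 u2 v1 v2 Aa].
  - move=> /rdiv_quo_class uv.
    exact: (fixE _ _ _ Aa (parallel_Tin uv) (Tin1 u) (Tin1 v)).
  - move=> /rdiv_quo_class uv.
    exact: (fixE _ _ _ Aa (parallel_Uin uv) (Uin1 u) (Uin1 v)).
  - move=> /rdiv_quo_class e1 /rdiv_quo_class e2.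
    exact: (fixE _ _ _ Aa (parallel_Lin e1 e2) (Lin1 _ _) (Lin1 _ _)).
  - move=> /rdiv_quo_class e1 /rdiv_quo_class e2.
    exact: (fixE _ _ _ Aa (parallel_Rin e1 e2) (Rin1 _ _) (Rin1 _ _)).
  - move=> /rdiv_quo_class e1 /rdiv_quo_class e2.
    exact: (fixE _ _ _ Aa (parallel_Min e1 e2) (Min1 _ _) (Min1 _ _)).
(* The trivial subloop is normal, as the kernel of the identity homomorphism, so it bounds the
   commutator from above. *)
pose h := HB.pack_for {multiplicative Q -> Q} (@id Q)
  (isMultiplicative.Build Q Q id (fun _ _ => erefl)).
apply/seteqP; split; first by apply: smallest_sub => //; exists Q, h.
move=> _ ->; have normC := smallest_normal (comm_gen A A).
exact: (set_mem (nsub1 (NormalSubloop normC))).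
Qed.

Lemma affine_inner_words : inner_words_agree A.
Proof.
move=> n W innW u v uv a Aa.
have {}uv i : cl (u i) = cl (v i) by apply/rdiv_quo_class.
have pW := parallel_word W uv.
(* W_v fixes 1 and reflects congruence modulo [A], so the preimage of a, like a itself, is congruent
   to 1. *)
have Ab : A ((word_eval v W)^-1 a).
  apply/quo_class_eq1; rewrite -quo_class1.
  apply: (parallel_cl_inv (parallel_word W (fun i => erefl (cl (v i))))).
  by rewrite innW [word_eval v W _]perm_invK; apply/quo_class_eq1.
have := parallel_fix1 pW (innW Q u) (innW Q v) (to_subloop Ab).
by rewrite /= perm_invK.
Qed.

Lemma affine_inner_aut : inner_aut_and_identities A.
Proof.
have cl1 x : A x -> cl x = cl 1 by move=> Ax; apply/quo_class_eq1.
split.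
- move=> p [Mp p1]; have [_ [s sM sE]] := parallel_Mlt Mp 1.
  have pE a : p (val a) = val (s a).
    by have [+ _] := sE 1 erefl a; rewrite p1 !rmul1.
  split.
    split=> [a Aa|a b _ _ /(can_inj (perm_funK p)) //|b Ab].
      have pa : p a = _ := pE (to_subloop Aa).
      by rewrite /= pa; apply/set_mem/valP.
    exists (val (s^-1 (to_subloop Ab))); first exact/set_mem/valP.
    by rewrite pE [s _]perm_invK.
  move=> a b Aa Ab; have := pE (to_subloop Aa * to_subloop Ab).
  by rewrite sM /= -!pE.
(* In each identity a parameter from [A] is replaced by the congruent element 1. *)
- move=> a b x Aa Ab; split.
  + rewrite /loop_comm -[b]/(val (to_subloop Ab)).
    rewrite (parallel_fix1 (parallel_Tin (cl1 _ Aa)) (Tin1 _) (Tin1 _)).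
    by rewrite /= lmul1 rdivx1 rdivxx.
  + rewrite /loop_assoc -[a]/(val (to_subloop Aa)).
    rewrite (parallel_fix1 (parallel_Rin (erefl (cl x)) (cl1 _ Ab))
      (Rin1 _ _) (Rin1 _ _)).
    by rewrite /= rmul1 lmul1 rmulK rdivxx.
  + rewrite /loop_assoc -[a]/(val (to_subloop Aa)).
    rewrite (parallel_fix1 (parallel_Rin (cl1 _ Ab) (erefl (cl x)))
      (Rin1 _ _) (Rin1 _ _)).
    by rewrite /= !rmul1 rmulK rdivxx.
  (* In [x,a,b] the argument x of R_{b,a} need not lie in [A], so L is used instead: L_{x,a}(b) =
     L_{x,1}(b) = b. *)
  + have := parallel_fix1 (parallel_Lin (erefl (cl x)) (cl1 _ Aa))
      (Lin1 _ _) (Lin1 _ _) (to_subloop Ab).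
    rewrite [X in _ = X]/= lmul1 rmul1 lmulK => e.
    have {}e : x * a * b = x * (a * b) by rewrite -LinE [Lin x a b]e.
    by rewrite loop_assocE e rmulK rdivxx.
- move=> a x u v Aa /rdiv_quo_class uv; rewrite /loop_assoc.
  rewrite -[a]/(val (to_subloop Aa)).
  by rewrite (parallel_fix1 (parallel_Rin uv (erefl (cl x))) (Rin1 _ _) (Rin1 _ _)).
Qed.

Lemma affine_abelian_extension : is_abelian_extension A.
Proof.
have [mulC mulA affM] := affA.
have hA : comm_group (subloop A).
  by split=> [a b c|a b]; [apply: val_inj; apply/esym/mulA | exact: mulC].
(* A choice of coset representatives normalized by [l 1 = 1]; this yields the cocycle normalizations
   and f(a,1) = a. *)
pose l (X : quotient A) : Q :=
  if pselect (X = 1) then 1 else sval (cid (quo_classP X)).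
have lE X : cl (l X) = X.
  by rewrite /l; case: pselect => [X1|_] /=; [rewrite X1 | case: cid].
have l1 : l 1 = 1 by rewrite /l; case: pselect.
pose fs X Y := cid (affM (l X) (l Y)); pose gs X Y := cid (svalP (fs X Y)).
pose f X Y := sval (fs X Y); pose g X Y := sval (gs X Y).
have fM X Y : is_aut (f X Y) by case: (svalP (gs X Y)).
have gM X Y : is_aut (g X Y) by case: (svalP (gs X Y)).
have fgE X Y a b :
    (val a * l X) * (val b * l Y) = val (f X Y a) * (val (g X Y b) * (l X * l Y)).
  by case: (svalP (gs X Y)).
have At X Y : A ((l X * l Y) / l (X * Y)).
  by apply/rdiv_quo_class; rewrite quo_classM !lE.
(* The cocycle theta measures how far [l] is from being a homomorphism. *)
pose t X Y := to_subloop (At X Y).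
have f1 X a : f X 1 a = a.
  have := fgE X 1 a 1; rewrite is_aut1 // l1 !lmul1 !rmul1.
  by move=> /rmulI/val_inj <-.
have g1 X a : g 1 X a = a.
  have := fgE 1 X 1 a; rewrite is_aut1 // l1 !lmul1.
  by move=> /rmulI/val_inj <-.
have t1l X : t 1 X = 1.
  by apply: val_inj; rewrite /= l1 !lmul1 rdivxx.
have t1r X : t X 1 = 1.
  by apply: val_inj; rewrite /= l1 !rmul1 rdivxx.
pose V := zmod_of hA.
pose Gamma := @LoopCocycle V (quotient A)
  (fun X Y => @ZmodAut V (f X Y) (fM X Y))
  (fun X Y => @ZmodAut V (g X Y) (gM X Y)) t f1 g1 t1l t1r.
pose h (p : abelian_extension Gamma) : Q := val (p.1 : subloop A) * l p.2.
have hM : {morph h : p q / p * q}.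
  (* With l(X)l(Y) = t(X,Y)l(XY), the affine formula for representatives becomes the multiplication
     of the extension. *)
  move=> [a X] [b Y]; apply: etrans (esym (fgE X Y a b)).
  by rewrite -[l X * l Y](rdivK (l (X * Y))) -[_ / _]/(val (t X Y)) -!mulA.
pose hm := isMultiplicative.Build (abelian_extension Gamma) Q h hM.
pose H : {multiplicative abelian_extension Gamma -> Q} := HB.pack h hm.
have clh (p : abelian_extension Gamma) : cl (h p) = p.2 by rewrite quo_class_valM lE.
exists hA, Gamma, H; split.
- have Ah x : A (x / l (cl x)) by apply/rdiv_quo_class; rewrite lE.
  exists (fun x => (to_subloop (Ah x), cl x)) => [p|x]; last exact: rdivK.
  have := clh p; case: p => a X clp; apply: (congr2 pair _ clp).
  apply: val_inj; rewrite /=.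
  have -> : l (cl (H (a, X))) = l X by rewrite [cl _]clp.
  exact: rmulK.
- by move=> a; rewrite /= /h /= l1 rmul1.
- by move=> a X; apply: val_quotient; apply: clh.
Qed.

End ParallelMaps.

Theorem theorem4p1 (Q : loopType) (A : normalSubloop Q) :
  [<-> abelian_in A;
       inner_words_agree A;
       inner_aut_and_identities A;
       is_abelian_extension A].
Proof.
tfae.
- move=> /commutator_inner_maps/inner_maps_agree_affine; exact: affine_inner_words.
- move=> /inner_words_inner_maps/inner_maps_agree_affine; exact: affine_inner_aut.
- move=> /inner_aut_affine; exact: affine_abelian_extension.
- move=> /abelian_extension_affine; exact: affine_abelian.
Qed.
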